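(* Let $a\in\mathbb{Z}$, and let $N^{(a)}_{m,k}(q^{1/2})$ ($m\ge1$, $k\ge0$) be defined by the identity $$\sum_{n=1}^\infty\sum_{m\ge1,\,k\ge0}\frac{N^{(a)}_{m,k}(q^{n/2})}{i[n]}\,e^{-nkt}x^{nm}=\sum_{n=1}^\infty\frac{((-1)^ax)^n}{i}\sum_{j=0}^n\frac{\prod_{k=1}^{n-1}[an+j+k]}{[j]!\,[n-j]!}\,(-e^{-t})^j .$$ Then for all $m\ge1$ and $0\le k\le m$, $$\frac{N^{(a)}_{m,k}(q^{1/2})}{[1]}=\sum_{n\mid(k,m)}\mu(n)\,(-1)^{(ma+k)/n}\,\frac{\prod_{j=1}^{m/n-1}[am+nj+k]}{\prod_{j=1}^{k/n}[nj]\cdot\prod_{j=1}^{(m-k)/n}[nj]} .$$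
   Context: Here $i=\sqrt{-1}$, $q=e^{i\lambda}$, $q^{r}=e^{ir\lambda}$, $[r]=q^{r/2}-q^{-r/2}$, $[r]!=\prod_{k=1}^r[k]$ with $[0]!=1$; empty products equal $1$; $\mu(n)$ is the M\''obius function and $(k,m)$ the greatest common divisor (with $(0,m)=m$). The identity is one of formal power series in $x$ with coefficients polynomial in $e^{-t}$; $N^{(a)}_{m,k}(q^{n/2})$ denotes the result of replacing $q^{1/2}$ by $q^{n/2}$ (i.e. $\lambda$ by $n\lambda$) in $N^{(a)}_{m,k}(q^{1/2})$. (These are the Ooguri-Vafa type invariants attached to the all-genera one-point open string function of the resolved conifold with one outer brane in framing $a$; in the paper $N^{(a)}_{m,k}(q^{1/2})=\sum_{s\in\frac12\mathbb{Z}}N^{(a)}_{m,k,s}q^s$.) *)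

(* Defs.v *)
From HB Require Import structures.
From mathcomp Require Import all_boot all_order all_algebra.
From mathcomp Require Import complex.
From mathcomp Require Import reals sequences exp trigo.
Set Implicit Arguments.
Unset Strict Implicit.
Unset Printing Implicit Defensive.
Import Order.TTheory GRing.Theory Num.Theory.
Local Open Scope ring_scope.

Definition moebius (n : nat) : int :=
  if all (fun p => logn p n == 1)%N (primes n) then (-1) ^+ size (primes n)
  else 0.

Definition cexp (R : realType) (z : R[i]) : R[i] :=
  (expR (complex.Re z))%:C%C
    * ((cos (complex.Im z)) +i* (sin (complex.Im z)))%C.

(* [qpow l r] is q^r = e^(i r l); it is determined by l (not just by q), so
   that half-integral powers are unambiguous: [qpow l (1/2)] is q^(1/2). *)
Definition qpow (R : realType) (l r : R[i]) : R[i] := cexp ('i%C * r * l).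

Definition qint (R : realType) (l : R[i]) (r : int) : R[i] :=
  qpow l (r%:~R / 2) - qpow l (- (r%:~R / 2)).

Definition qfact (R : realType) (l : R[i]) (r : nat) : R[i] :=
  \prod_(1 <= k < r.+1) qint l k.

(* The values of l at which no denominator [n] vanishes, i.e. q is not a root
   of unity. This set is stable under l |-> n * l for n >= 1. *)
Definition generic (R : realType) (l : R[i]) : Prop :=
  forall n : nat, (0 < n)%N -> qint l n != 0.

(* In C[y][x] = {poly {poly C}}, the outer variable is x and the inner one is
   y = e^(-t). The partial sums [s b] converge in C[y][[x]] to the power series
   with coefficients [S]: each coefficient of x is eventually constant. *)
Definition fps_cvg (C : nzRingType) (s : nat -> {poly {poly C}})
    (S : nat -> {poly C}) : Prop :=
  forall M : nat, exists B : nat, forall b : nat, (B <= b)%N -> (s b)`_M = S M.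

Definition fps_eq (C : nzRingType) (s s' : nat -> {poly {poly C}}) : Prop :=
  exists S : nat -> {poly C}, fps_cvg s S /\ fps_cvg s' S.

(* The argument of [N m k] is the value of q^(1/2), so that [qpow l (n / 2)]
   is the substitution q^(1/2) |-> q^(n/2). *)
Definition lhs_partial (R : realType) (N : nat -> nat -> R[i] -> R[i])
    (l : R[i]) (b : nat) : {poly {poly R[i]}} :=
  \sum_(1 <= n < b) \sum_(1 <= m < b) \sum_(0 <= k < b)
    ((N m k (qpow l (n%:R / 2)) / ('i%C * qint l n)) *: 'X^((n * k)%N))
      *: 'X^((n * m)%N).

Definition rhs_partial (R : realType) (a : int)
    (l : R[i]) (b : nat) : {poly {poly R[i]}} :=
  \sum_(1 <= n < b)
    ('i%C^-1 *:
       \sum_(0 <= j < n.+1)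
         ((\prod_(1 <= k < n) qint l (a * n%:Z + j%:Z + k%:Z))
            / (qfact l j * qfact l (n - j))) *: (- 'X) ^+ j)
    *: (((-1) ^ a)%:P *: 'X) ^+ n.

(* N is the family of invariants defined by the generating identity. *)
Definition is_OV_invariants (R : realType) (a : int)
    (N : nat -> nat -> R[i] -> R[i]) : Prop :=
  forall l : R[i], generic l -> fps_eq (lhs_partial N l) (rhs_partial a l).

(* Main.v *)
Require Import Defs.
From HB Require Import structures.
From mathcomp Require Import all_boot all_order all_algebra.
From mathcomp Require Import complex.
From mathcomp Require Import reals sequences exp trigo.
From mathcomp Require Import ring.
Import Order.TTheory GRing.Theory Num.Theory.
Local Open Scope ring_scope.

(** Comparing the coefficients of [x^M y^K] turns the generating identity into
    a divisor sum over the common divisors of [M] and [K], whose terms are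
    invariants with [l] scaled to [n * l]. Scaling by [n] turns [r] into [n r],
    so the identity at [n * l], for the exponents [m / n] and [k / n], has
    terms of the same shape, indexed by the multiples of [n] dividing
    [gcd (k, m)]; Möbius inversion then isolates the term [n = 1]. *)

(** * Divisor sums and Möbius inversion *)

Lemma divisors_filter_multiples (g n : nat) : (0 < g)%N -> (n %| g)%N ->
  perm_eq [seq e <- divisors g | (n %| e)%N]
          [seq (n * d)%N | d <- divisors (g %/ n)].
Proof.
move=> g0 ng; have n0 := dvdn_gt0 g0 ng.
have q0 : (0 < g %/ n)%N by rewrite divn_gt0 // dvdn_leq.
apply: uniq_perm.
- exact/filter_uniq/divisors_uniq.
- rewrite map_inj_uniq ?divisors_uniq // => x y /eqP.
  by rewrite eqn_pmul2l // => /eqP.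
move=> e; rewrite mem_filter -dvdn_divisors //.
apply/andP/mapP => [[/dvdnP[d ->] dg]|[d + ->]].
  exists d; last by rewrite mulnC.
  by rewrite -dvdn_divisors // dvdn_divRL.
rewrite -dvdn_divisors // dvdn_divRL // => dg.
by rewrite dvdn_mulr // mulnC.
Qed.

Lemma divisors_filter_dvdn (g e : nat) : (0 < g)%N -> (e %| g)%N ->
  perm_eq [seq n <- divisors g | (n %| e)%N] (divisors e).
Proof.
move=> g0 eg; have e0 := dvdn_gt0 g0 eg.
apply: uniq_perm; rewrite ?filter_uniq ?divisors_uniq // => n.
rewrite mem_filter -!dvdn_divisors //.
by case: (boolP (n %| e)%N) => // ne; rewrite (dvdn_trans ne eg).
Qed.

Lemma moebius_primeM (p n : nat) : prime p -> (0 < n)%N ->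
  moebius (p * n) = if (p %| n)%N then 0 else - moebius n.
Proof.
move=> pp n0; have p0 := prime_gt0 pp.
have pn0 : (0 < p * n)%N by rewrite muln_gt0 p0.
case: ifPn => [pn|pNn].
  rewrite /moebius ifF //; apply/negbTE/allPn; exists p.
    by rewrite mem_primes pp pn0 dvdn_mulr.
  rewrite lognM // logn_prime // eqxx add1n eqSS -lt0n logn_gt0.
  by rewrite mem_primes pp n0.
have primesM : perm_eq (primes (p * n)) (p :: primes n).
  apply: uniq_perm; rewrite /= ?primes_uniq ?mem_primes ?(negbTE pNn) ?andbF //.
  by move=> r; rewrite primesM // inE primes_prime // inE.
rewrite /moebius (perm_size primesM) (perm_all _ primesM) /=.
rewrite lognM // logn_prime // eqxx lognE pp n0 (negbTE pNn) /=.
have -> : all (fun r => logn r (p * n) == 1)%N (primes n)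
        = all (fun r => logn r n == 1)%N (primes n).
  apply: eq_in_all => r; rewrite mem_primes => /and3P[pr _ rn].
  have rp : r != p by apply: contraNneq pNn => <-.
  by rewrite lognM // logn_prime // (negbTE rp).
by case: ifP => _; rewrite ?oppr0 // exprS mulN1r.
Qed.

(** For [e > 1], take a prime [p] dividing [e]. The divisors [p * n] contribute [- moebius n] if [p]
    does not divide [n], and 0 otherwise; this cancels the contribution of the divisors prime to
    [p]. *)
Lemma sum_moebius (e : nat) : (0 < e)%N ->
  \sum_(n <- divisors e) moebius n = (e == 1%N)%:R.
Proof.
move=> e0; case: eqVneq => [->|e1]; first by rewrite big_seq1.
have e_gt1 : (1 < e)%N by rewrite ltn_neqAle eq_sym e1.
set p := pdiv e; have pp : prime p by exact: pdiv_prime.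
have pe : (p %| e)%N by exact: pdiv_dvd.
have p0 := prime_gt0 pp.
have q0 : (0 < e %/ p)%N by rewrite divn_gt0 // dvdn_leq.
rewrite (bigID (fun n => (p %| n)%N)) /= -big_filter.
rewrite (perm_big _ (divisors_filter_multiples _ _ e0 pe)) big_map /=.
rewrite big_seq (eq_bigr (fun n => - (if (p %| n)%N then 0 else moebius n))).
  rewrite sumrN -big_seq.
  under eq_bigr => n _ do rewrite -if_neg.
  rewrite -big_mkcond /= -(perm_big _ (divisors_filter_dvdn _ _ e0
    (dvdn_div pe))).
  rewrite big_filter_cond; apply/eqP; rewrite addrC subr_eq0; apply/eqP.
  rewrite [LHS]big_seq_cond [RHS]big_seq_cond; apply: eq_bigl => n.
  rewrite -dvdn_divisors //; case: (boolP (n %| e)%N) => //= ne.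
  case: (boolP (p %| n)%N) => [|pNn]; rewrite ?andbF //= andbT.
  (* Being coprime to [p], [n] divides [e] exactly when it divides [e %/ p], so the two sums run
     over the same indices. *)
  have cnp : coprime n p by rewrite coprime_sym prime_coprime.
  by rewrite -(Gauss_dvdl _ cnp) divnK.
move=> n; rewrite -dvdn_divisors // => nq.
rewrite moebius_primeM ?(dvdn_gt0 q0) //.
by case: ifP; rewrite ?oppr0.
Qed.

Lemma sum_pred1_seq (V : nmodType) (I : eqType) (r : seq I) (j : I)
    (F : I -> V) : uniq r ->
  \sum_(i <- r | i == j) F i = if j \in r then F j else 0.
Proof.
move=> ur; case: ifPn => jr.
  by rewrite -big_filter filter_pred1_uniq // big_seq1.
by rewrite big_seq_cond big1 // => i /andP[ir /eqP ij]; rewrite -ij ir in jr.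
Qed.

(** [G n] sums [F] over the multiples of [n] dividing [g]. Exchanging the sums gives [F e] the
    weight [sum_moebius e], which vanishes unless [e] is 1. *)
Lemma moebius_inversion (R : pzRingType) (F G : nat -> R) (g : nat) :
    (0 < g)%N ->
    (forall n, (n %| g)%N -> G n = \sum_(d <- divisors (g %/ n)) F (n * d)%N) ->
  \sum_(n <- divisors g) (moebius n)%:~R * G n = F 1%N.
Proof.
move=> g0 GF.
transitivity (\sum_(n <- divisors g) \sum_(e <- divisors g | (n %| e)%N)
    (moebius n)%:~R * F e).
  apply: eq_big_seq => n; rewrite -dvdn_divisors // => ng.
  rewrite -mulr_sumr GF //; congr (_ * _).
  rewrite -[in RHS]big_filter.
  by rewrite (perm_big _ (divisors_filter_multiples _ _ g0 ng)) big_map.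
rewrite (exchange_big_dep predT) //=.
have H : {in divisors g, forall e,
    \sum_(n <- divisors g | (n %| e)%N) (moebius n)%:~R * F e
    = if e == 1%N then F e else 0}.
  move=> e; rewrite -dvdn_divisors // => eg.
  rewrite -mulr_suml -big_filter (perm_big _ (divisors_filter_dvdn _ _ g0 eg)).
  rewrite -(rmorph_sum (intmul (1 : R))) sum_moebius ?(dvdn_gt0 g0 eg) //=.
  by case: eqP => _; rewrite ?mul1r ?mul0r.
rewrite (eq_big_seq _ H) -big_mkcond /= sum_pred1_seq ?divisors_uniq //.
by rewrite -dvdn_divisors // dvd1n.
Qed.

(** * Scaling [l] by a positive integer *)

Section Dilation.
Variables (R : realType) (l : R[i]) (n : nat).

Lemma qpow_dilation : qpow (n%:R * l) (1 / 2) = qpow l (n%:R / 2).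
Proof. by rewrite /qpow; congr cexp; ring. Qed.

Lemma qint_dilation (r : int) : qint (n%:R * l) r = qint l (n%:Z * r).
Proof.
rewrite /qint /qpow; congr (cexp _ - cexp _); rewrite intrM -pmulrn; ring.
Qed.

Lemma generic_dilation : (0 < n)%N -> generic l -> generic (n%:R * l).
Proof.
by move=> n0 gl r r0; rewrite qint_dilation -PoszM; apply: gl; rewrite muln_gt0 n0.
Qed.

End Dilation.

(** The bounds on [M] keep the quotient inside the range of summation; [lo] is 1 for exponents of
    [x] and 0 for exponents of [y]. *)
Lemma sum_nat_muln_eq (V : nmodType) (F : nat -> V) (n M lo b : nat) :
    (0 < n)%N -> (lo * n <= M < b)%N ->
  \sum_(lo <= m < b | M == (n * m)%N) F m = if (n %| M)%N then F (M %/ n)%N else 0.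
Proof.
move=> n0 /andP[loM Mb]; case: ifPn => [/dvdnP[d dM]|nM]; last first.
  rewrite big1 // => m /eqP Mm; by rewrite Mm dvdn_mulr in nM.
rewrite dM mulnK //.
under eq_bigl => m do rewrite mulnC eqn_pmul2l // eq_sym.
rewrite sum_pred1_seq ?iota_uniq // mem_index_iota.
rewrite dM leq_pmul2r // in loM; rewrite loM.
by rewrite (leq_ltn_trans _ Mb) // dM leq_pmulr.
Qed.

Lemma sum_nat_divisors (V : nmodType) (F : nat -> V) (g b : nat) :
  (0 < g < b)%N -> \sum_(1 <= n < b | (n %| g)%N) F n = \sum_(n <- divisors g) F n.
Proof.
move=> /andP[g0 gb]; rewrite -big_filter; apply: perm_big.
apply: uniq_perm; rewrite ?filter_uniq ?iota_uniq ?divisors_uniq // => n.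
rewrite mem_filter mem_index_iota -dvdn_divisors //.
case: (boolP (n %| g)%N) => //= ng.
by rewrite (dvdn_gt0 g0 ng) (leq_ltn_trans (dvdn_leq g0 ng)).
Qed.

(** The conditions [M = n * m] and [K = n * k] make [n] a common divisor and determine [m] and [k].
    Truncation at [b > M, K] loses none of these terms. *)
Lemma coef_lhs_partial (R : realType) (N : nat -> nat -> R[i] -> R[i])
    (l : R[i]) (b M K : nat) : (0 < M < b)%N -> (K < b)%N ->
  (lhs_partial N l b)`_M`_K = \sum_(n <- divisors (gcdn K M))
     N (M %/ n)%N (K %/ n)%N (qpow l (n%:R / 2)) / ('i%C * qint l n).
Proof.
move=> /andP[M0 Mb] Kb.
have g0 : (0 < gcdn K M)%N by rewrite gcdn_gt0 M0 orbT.
rewrite -(@sum_nat_divisors _ _ _ b); last first.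
  by rewrite g0 (leq_ltn_trans _ Mb) // dvdn_leq // dvdn_gcdr.
rewrite /lhs_partial !coef_sum [RHS]big_mkcond; apply: eq_big_nat => n /andP[n0 _].
transitivity (\sum_(1 <= m < b | M == (n * m)%N) \sum_(0 <= k < b | K == (n * k)%N)
    N m k (qpow l (n%:R / 2)) / ('i%C * qint l n)).
  rewrite coef_sum coef_sum [RHS]big_mkcond; apply: eq_bigr => m _.
  rewrite -scaler_suml coefZ coefXn; case: eqP => _; last by rewrite mulr0 coef0.
  rewrite mulr1 coef_sum [RHS]big_mkcond; apply: eq_bigr => k _.
  by rewrite coefZ coefXn; case: eqP; rewrite ?mulr1 ?mulr0.
under eq_bigr => m _ do rewrite sum_nat_muln_eq ?Kb //.
(* If [n > M], both sides vanish: [n] cannot divide the positive [M], and no [m >= 1] satisfies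
   [n * m = M]. *)
rewrite dvdn_gcd andbC; case: (leqP (1 * n) M) => nM.
  by rewrite sum_nat_muln_eq ?nM //; case: ifP => //=; case: ifP.
rewrite mul1n in nM; rewrite (gtnNdvd M0 nM) /= big1_seq // => m.
rewrite mem_index_iota => /andP[/eqP Mm /andP[m0 _]].
by rewrite Mm ltnNge leq_pmulr in nM.
Qed.

(** Only [n = M] and [j = K] contribute; the sign combines [((-1) ^ a) ^+ M] with the [(-1) ^+ K]
    coming from [(- 'X) ^+ K]. *)
Lemma coef_rhs_partial (R : realType) (a : int) (l : R[i]) (b M K : nat) :
    (0 < M < b)%N -> (K <= M)%N ->
  (rhs_partial a l b)`_M`_K = 'i%C^-1 * ((-1) ^ (M%:Z * a + K%:Z)
     * ((\prod_(1 <= j < M) qint l (a * M%:Z + K%:Z + j%:Z))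
        / (qfact l K * qfact l (M - K)))).
Proof.
move=> Mb KM; rewrite /rhs_partial !coef_sum.
transitivity (\sum_(1 <= n < b | M == n) ('i%C^-1 * ((-1) ^ (n%:Z * a + K%:Z)
     * ((\prod_(1 <= j < n) qint l (a * n%:Z + K%:Z + j%:Z))
        / (qfact l K * qfact l (n - K)))))); last first.
  rewrite (eq_bigl (eq_op^~ M)) => [|n]; last by rewrite eq_sym.
  by rewrite sum_pred1_seq ?iota_uniq // mem_index_iota Mb.
rewrite [RHS]big_mkcond; apply: eq_bigr => n _.
rewrite exprZn coefZ coefZ coefXn; case: eqP => [<-|_]; last first.
  by rewrite !mulr0 coef0.
rewrite mulr1 -rmorphXn /= mulrC mul_polyC coefZ coefZ coef_sum.
rewrite (eq_bigr (fun j => if j == K then (-1) ^+ K *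
  ((\prod_(1 <= j < M) qint l (a * M%:Z + K%:Z + j%:Z))
        / (qfact l K * qfact l (M - K))) else 0)); last first.
  move=> j _; rewrite coefZ -scaleN1r exprZn coefZ coefXn eq_sym.
  by case: eqP => [->|_]; rewrite ?mulr1 ?mulr0 // mulrC.
rewrite -big_mkcond sum_pred1_seq ?iota_uniq ?mem_index_iota //.
rewrite expfzDr ?oppr_eq0 ?oner_eq0 // [(M%:Z * a)]mulrC -exprz_exp.
by rewrite leq0n ltnS KM mulrCA -!exprnP !mulrA.
Qed.

Theorem mainTheorem10 (R : realType) (a : int)
    (N : nat -> nat -> R[i] -> R[i]) (hN : is_OV_invariants a N)
    (m k : nat) (hm : (1 <= m)%N) (hk : (k <= m)%N)
    (l : R[i]) (hl : generic l) :
  N m k (qpow l (1 / 2)) / qint l 1 =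
    \sum_(n <- divisors (gcdn k m))
      (moebius n)%:~R * (-1) ^ ((m%:Z * a + k%:Z) %/ n%:Z)%Z
        * ((\prod_(1 <= j < m %/ n) qint l (a * m%:Z + n%:Z * j%:Z + k%:Z))
           / ((\prod_(1 <= j < (k %/ n).+1) qint l (n%:Z * j%:Z))
              * (\prod_(1 <= j < ((m - k) %/ n).+1) qint l (n%:Z * j%:Z)))).

Proof.
pose F e : R[i] := N (m %/ e)%N (k %/ e)%N (qpow l (e%:R / 2)) / qint l e.
have g0 : (0 < gcdn k m)%N by rewrite gcdn_gt0 hm orbT.
transitivity (F 1%N); first by rewrite /F !divn1.
(* Up to the factor [1 / i], this is the right-hand coefficient at exponents [m %/ n] and [k %/ n],
   with parameter [n * l]. *)
pose G (n : nat) : R[i] := (-1) ^ ((m %/ n)%:Z * a + (k %/ n)%:Z)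
     * ((\prod_(1 <= j < m %/ n)
           qint (n%:R * l) (a * (m %/ n)%:Z + (k %/ n)%:Z + j%:Z))
        / (qfact (n%:R * l) (k %/ n) * qfact (n%:R * l) (m %/ n - k %/ n))).
have GF n : (n %| gcdn k m)%N ->
    G n = \sum_(d <- divisors (gcdn k m %/ n)) F (n * d)%N.
  move=> ng; have n0 := dvdn_gt0 g0 ng.
  have [nk nm] : (n %| k)%N /\ (n %| m)%N by apply/andP; rewrite -dvdn_gcd.
  have [S [lS rS]] := hN _ (generic_dilation _ _ _ n0 hl).
  have [B1 HB1] := lS (m %/ n)%N; have [B2 HB2] := rS (m %/ n)%N.
  (* Past [B1] and [B2] both coefficients equal their common limit; past [m] the coefficient
     formulas apply. *)
  pose b := maxn (maxn B1 B2) m.+1.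
  have mb : (0 < m %/ n < b)%N.
    rewrite divn_gt0 // dvdn_leq //= /b leq_max; apply/orP; right.
    by rewrite ltnS leq_div.
  have kb : (k %/ n < b)%N.
    by rewrite (leq_ltn_trans (leq_div2r n hk)) //; case/andP: mb.
  have iU : ('i%C : R[i]) != 0 by rewrite neq0Ci.
  have := coef_lhs_partial _ N (n%:R * l) _ _ _ mb kb.
  rewrite HB1 ?/b -?maxnA ?leq_maxl // -(HB2 b) ?/b ?leq_max ?leqnn ?orbT //.
  rewrite coef_rhs_partial // ?leq_div2r // -/(G n) => /(congr1 ( *%R 'i%C)).
  rewrite mulVKf // => ->; rewrite mulr_sumr.
  have -> : gcdn (k %/ n) (m %/ n) = (gcdn k m %/ n)%N.
    by apply/eqP; rewrite eqn_div // muln_gcdl !divnK.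
  apply: eq_bigr => d _; rewrite /F invfM mulrCA mulVKf //.
  rewrite -!divnMA qint_dilation -PoszM; congr (N _ _ _ / _).
  (* With both values written at exponent 1/2, scaling by [n] and then by [d] is scaling by
     [n * d]. *)
  by rewrite -[RHS]qpow_dilation -qpow_dilation mulrA [d%:R * _]mulrC -natrM.
rewrite -(moebius_inversion _ _ _ _ g0 GF).
apply: eq_big_seq => n; rewrite -dvdn_divisors // => ng.
have n0 := dvdn_gt0 g0 ng.
have [nk nm] : (n %| k)%N /\ (n %| m)%N by apply/andP; rewrite -dvdn_gcd.
rewrite -mulrA; congr (_ * _); rewrite /G /qfact divnBr //.
have nZ : n%:Z != 0 by rewrite eqz_nat -lt0n.
have mE : m%:Z = (m %/ n)%:Z * n%:Z by rewrite -PoszM divnK.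
have kE : k%:Z = (k %/ n)%:Z * n%:Z by rewrite -PoszM divnK.
congr (_ ^ _ * (_ / (_ * _))).
(* The integer division in the exponent is exact, as [n] divides both [m] and [k]. *)
- by rewrite mE kE mulrAC -mulrDl mulzK.
- apply: eq_bigr => j _; rewrite qint_dilation mE kE; congr qint; ring.
- by apply: eq_bigr => j _; rewrite qint_dilation.
- by apply: eq_bigr => j _; rewrite qint_dilation.
Qed.
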